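(* Let $U$ and $L$ be semi-infinite matrices (rows and columns indexed by $\mathbb N_0$), $U$ upper bidiagonal and $L$ lower bidiagonal, with \[ U_{n,n}=u_n>0,\quad U_{n,n+1}=1,\quad L_{n,n}=1,\quad L_{n+1,n}=\ell_n>0\qquad(n\in\mathbb N_0) \] and all other entries zero. Then there is a unique normalized positive pair $\widetilde L,\widetilde U$ (with $\widetilde L$ lower bidiagonal and $\widetilde U$ upper bidiagonal) such that \[ UL=\widetilde L\,\widetilde U . \] Writing $\widetilde L_{n+1,n}=\widetilde\ell_n$ and $\widetilde U_{n,n}=\widetilde u_n$, the nontrivial entries are determined recursively by \[ \widetilde u_0=u_0+\ell_0,\qquad \widetilde\ell_n=\frac{u_{n+1}\ell_n}{\widetilde u_n},\qquad \widetilde u_{n+1}=u_{n+1}+\ell_{n+1}-\widetilde\ell_n,\qquad n\in\mathbb N_0 . \] More precisely, $\widetilde u_n>\ell_n$ and $0<\widetilde\ell_n<u_{n+1}$ for every $n\in\mathbb N_0$. If the two original coefficient sequences $(u_n)$ and $(\ell_n)$ are bounded, then so are the refactorized sequences $(\widetilde u_n)$ and $(\widetilde\ell_n)$.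
   Context: A lower bidiagonal semi-infinite matrix $L$ (only the diagonal and first subdiagonal may be nonzero) is normalized if $L_{n,n}=1$ for all $n$; an upper bidiagonal semi-infinite matrix $U$ (only the diagonal and first superdiagonal may be nonzero) is normalized if $U_{n,n+1}=1$ for all $n$. The remaining entries $L_{n+1,n}$ and $U_{n,n}$ are the nontrivial entries. A normalized pair is positive if all its nontrivial entries are strictly positive. *)

(* Defs.v *)
From mathcomp Require Import all_boot all_order all_algebra.
From mathcomp Require Import all_classical all_reals all_analysis.
Set Implicit Arguments.
Unset Strict Implicit.
Unset Printing Implicit Defensive.
Import Order.TTheory GRing.Theory Num.Theory.
Import numFieldNormedType.Exports.
Local Open Scope classical_set_scope.
Local Open Scope ring_scope.

Definition simx (R : Type) := nat -> nat -> R.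

(* The sum is the finitely supported one of [fsbigop], which is 0 by convention
   on an infinite support. In a product of two bidiagonal matrices every entry
   has a finite support, so the convention plays no role there. *)
Definition simulmx (R : pzRingType) (A B : simx R) : simx R :=
  fun i j => \sum_(k \in [set: nat]) (A i k * B k j).

Definition lower_bidiagonal (R : pzRingType) (A : simx R) : Prop :=
  forall i j, i != j -> i != j.+1 -> A i j = 0.

Definition upper_bidiagonal (R : pzRingType) (A : simx R) : Prop :=
  forall i j, j != i -> j != i.+1 -> A i j = 0.

Definition normalized_lower (R : pzRingType) (L : simx R) : Prop :=
  lower_bidiagonal L /\ (forall n, L n n = 1).

Definition normalized_upper (R : pzRingType) (U : simx R) : Prop :=
  upper_bidiagonal U /\ (forall n, U n n.+1 = 1).

Definition normalized_positive_pair (R : numDomainType) (L U : simx R) : Prop :=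
  [/\ normalized_lower L, normalized_upper U,
      forall n, 0 < L n.+1 n & forall n, 0 < U n n].

(* Main.v *)
Require Import Defs.
From mathcomp Require Import all_boot all_order all_algebra.
From mathcomp Require Import all_classical all_reals all_analysis.
Set Implicit Arguments.
Unset Strict Implicit.
Unset Printing Implicit Defensive.
Import Order.TTheory GRing.Theory Num.Theory.
Import numFieldNormedType.Exports.
Local Open Scope classical_set_scope.
Local Open Scope ring_scope.

(** Both products are tridiagonal with superdiagonal 1. Writing [lt], [ut] for
    the entries of the new factors, comparing diagonals and subdiagonals turns
    the matrix equation into
      ut 0 = u 0 + l 0,
      ut (n+1) + lt n = u (n+1) + l (n+1),
      lt n * ut n = u (n+1) * l n,
    which, as long as no pivot [ut n] vanishes, is the recursion [qd_step]: it
    has exactly one solution, computed entry by entry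
    ([factorization_eqP], [qd_step_pivot], [qd_step_uniq]).

    Everything then rests on the pivots staying positive, although the
    recursion subtracts. The invariant that survives the subtraction is
    [l n < ut n]: it makes the quotient [l n / ut n] smaller than 1, hence
    [lt n < u (n+1)], and this says exactly that
    [ut (n+1) - l (n+1) = u (n+1) - lt n] is positive again
    ([qd_step_pivot_gt], [qd_step_lower_itv]). The same inequalities, together
    with [ut n <= u n + l n], bound the new sequences by the old ones. *)

(** * Bidiagonal and tridiagonal matrices given by sequences *)

Definition unit_lower (R : pzRingType) (l : nat -> R) : simx R :=
  fun i j => if i == j then 1 else if i == j.+1 then l j else 0.

Definition unit_upper (R : pzRingType) (u : nat -> R) : simx R :=
  fun i j => if j == i then u i else if j == i.+1 then 1 else 0.

Definition unit_tridiagonal (R : pzRingType) (d s : nat -> R) : simx R :=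
  fun i j => if i == j then d j else if i == j.+1 then s j
             else if j == i.+1 then 1 else 0.

Lemma normalized_unit_lower (R : pzRingType) (l : nat -> R) :
  normalized_lower (unit_lower l).
Proof.
split=> [i j /negbTE ij /negbTE ij1|n]; last by rewrite /unit_lower eqxx.
by rewrite /unit_lower ij ij1.
Qed.

Lemma normalized_unit_upper (R : pzRingType) (u : nat -> R) :
  normalized_upper (unit_upper u).
Proof.
split=> [i j /negbTE ji /negbTE ji1|n]; first by rewrite /unit_upper ji ji1.
by rewrite /unit_upper eqxx gtn_eqF.
Qed.

Lemma unit_lower_sub (R : pzRingType) (l : nat -> R) n :
  unit_lower l n.+1 n = l n.
Proof. by rewrite /unit_lower eqxx gtn_eqF. Qed.

Lemma unit_upper_diag (R : pzRingType) (u : nat -> R) n :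
  unit_upper u n n = u n.
Proof. by rewrite /unit_upper eqxx. Qed.

Lemma normalized_lowerE (R : pzRingType) (L : simx R) :
  normalized_lower L -> L = unit_lower (fun n => L n.+1 n).
Proof.
move=> [L0 L1]; apply/funext => i; apply/funext => j; rewrite /unit_lower.
have [->|ij] := eqVneq i j; first exact: L1.
by have [->//|ij1] := eqVneq i j.+1; exact: L0.
Qed.

Lemma normalized_upperE (R : pzRingType) (U : simx R) :
  normalized_upper U -> U = unit_upper (fun n => U n n).
Proof.
move=> [U0 U1]; apply/funext => i; apply/funext => j; rewrite /unit_upper.
have [->//|ji] := eqVneq j i.
by have [->|ji1] := eqVneq j i.+1; [exact: U1|exact: U0].
Qed.

Lemma unit_tridiagonal_inj (R : pzRingType) (d s d' s' : nat -> R) :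
  unit_tridiagonal d s = unit_tridiagonal d' s' -> d = d' /\ s = s'.
Proof.
move=> eq_T; split; apply/funext => n.
- by have := congr1 (fun T : simx R => T n n) eq_T;
    rewrite /unit_tridiagonal eqxx.
- by have := congr1 (fun T : simx R => T n.+1 n) eq_T;
    rewrite /unit_tridiagonal eqxx gtn_eqF.
Qed.

(** * Products of bidiagonal matrices *)

(** The sum defining an entry is meaningful only on a finite support; a list
    containing the support of the row of [A] suffices, whatever [B] is. *)
Lemma simulmx_seq (R : pzRingType) (A B : simx R) (r : seq nat) i j :
  uniq r -> (forall k, k \notin r -> A i k = 0) ->
  simulmx A B i j = \sum_(k <- r) A i k * B k j.
Proof.
move=> r_uniq A0; rewrite /simulmx (fsbigE r)//.
  by apply: eq_bigl => k; rewrite in_setT.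
by move=> k _ /A0->; rewrite mul0r.
Qed.

Lemma mul_upper_lower (R : pzRingType) (u l : nat -> R) :
  simulmx (unit_upper u) (unit_lower l) =
  unit_tridiagonal (fun n => u n + l n) (fun n => u n.+1 * l n).
Proof.
apply/funext => i; apply/funext => j.
rewrite (@simulmx_seq _ _ _ [:: i; i.+1]); last 2 first.
- by rewrite /= inE ltn_eqF.
- by move=> k; rewrite !inE negb_or /unit_upper => /andP[/negbTE-> /negbTE->].
rewrite !big_cons big_nil addr0 /unit_upper !eqxx gtn_eqF// mul1r.
rewrite /unit_lower /unit_tridiagonal eqSS.
have [->|ij] := eqVneq i j; first by rewrite gtn_eqF// mulr1.
have [->|ij1] := eqVneq i j.+1; first by rewrite gtn_eqF// addr0.
by rewrite mulr0 add0r eq_sym.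
Qed.

(** The top left entry is special: the first row of the lower factor has no
    subdiagonal entry to contribute. *)
Lemma mul_lower_upper (R : pzRingType) (u l : nat -> R) :
  simulmx (unit_lower l) (unit_upper u) =
  unit_tridiagonal (fun n => if n is m.+1 then u n + l m else u 0%N)
                   (fun n => l n * u n).
Proof.
apply/funext => -[|i]; apply/funext => j.
  rewrite (@simulmx_seq _ _ _ [:: 0%N])//; last first.
    by move=> k; rewrite inE eq_sym /unit_lower => /negbTE->.
  rewrite big_seq1 /unit_lower eqxx mul1r /unit_upper /unit_tridiagonal.
  by rewrite [0%N == j]eq_sym; case: eqP => // ->.
rewrite (@simulmx_seq _ _ _ [:: i.+1; i]); last 2 first.
- by rewrite /= inE gtn_eqF.
- move=> k; rewrite !inE negb_or /unit_lower eq_sym eqSS => /andP[/negbTE->].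
  by rewrite eq_sym => /negbTE->.
rewrite !big_cons big_nil addr0 /unit_lower !eqxx gtn_eqF// mul1r.
rewrite /unit_upper /unit_tridiagonal eqSS [i.+1 == j]eq_sym [i == j]eq_sym.
have [->|ij] := eqVneq j i.+1; first by rewrite gtn_eqF// mulr1.
have [->|ji] := eqVneq j i; first by rewrite ltn_eqF// add0r.
by rewrite mulr0 addr0.
Qed.

(** * The recursion and its positivity *)

Definition qd_step (R : fieldType) (u l ut lt : nat -> R) : Prop :=
  [/\ ut 0%N = u 0%N + l 0%N,
      forall n : nat, lt n = u n.+1 * l n / ut n
    & forall n : nat, ut n.+1 = u n.+1 + l n.+1 - lt n].

Lemma factorization_eqP (R : fieldType) (u l ut lt : nat -> R) :
  (forall n, ut n != 0) ->
  simulmx (unit_upper u) (unit_lower l) =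
    simulmx (unit_lower lt) (unit_upper ut) <-> qd_step u l ut lt.
Proof.
move=> ut_neq0; rewrite mul_upper_lower mul_lower_upper; split.
  move=> /unit_tridiagonal_inj[eq_d eq_s]; split=> [|n|n].
  - by have /= := congr1 (fun d => d 0%N) eq_d.
  - by have /= -> := congr1 (fun s => s n) eq_s; rewrite mulfK.
  - by have /= -> := congr1 (fun d => d n.+1) eq_d; rewrite addrK.
move=> [ut0 ltE utS]; congr unit_tridiagonal; apply/funext.
  by case=> [|n]; rewrite ?ut0// utS subrK.
by move=> n; rewrite ltE divfK.
Qed.

Fixpoint pivot (R : fieldType) (u l : nat -> R) (n : nat) : R :=
  if n is m.+1 then u n + l n - u n * l m / pivot u l m else u 0%N + l 0%N.

Lemma qd_step_pivot (R : fieldType) (u l : nat -> R) :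
  qd_step u l (pivot u l) (fun n => u n.+1 * l n / pivot u l n).
Proof. by split. Qed.

Lemma qd_step_uniq (R : fieldType) (u l ut lt ut' lt' : nat -> R) :
  qd_step u l ut lt -> qd_step u l ut' lt' -> ut = ut' /\ lt = lt'.
Proof.
move=> [ut0 ltE utS] [ut0' ltE' utS'].
have eq_ut n : ut n = ut' n.
  by elim: n => [|n IH]; rewrite ?ut0 ?ut0'// utS utS' ltE ltE' IH.
by split; apply/funext => n //; rewrite ltE ltE' eq_ut.
Qed.

Section Positivity.
Variables (R : realFieldType) (u l ut lt : nat -> R).
Hypotheses (u_gt0 : forall n, 0 < u n) (l_gt0 : forall n, 0 < l n).
Hypothesis step : qd_step u l ut lt.

(** The new subdiagonal entry is [u n.+1] scaled by [l n / ut n < 1]. *)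
Lemma qd_step_lower_itv_of_pivot n : l n < ut n -> 0 < lt n < u n.+1.
Proof.
have [_ ltE _] := step.
move=> l_lt_ut; have ut_gt0 : 0 < ut n by exact: lt_trans l_lt_ut.
by rewrite ltE divr_gt0 ?mulr_gt0//= ltr_pdivrMr// ltr_pM2l.
Qed.

(** Positivity of [ut] alone is not inductive; the margin [l n] is what the
    subtraction in the next step consumes. *)
Lemma qd_step_pivot_gt n : l n < ut n.
Proof.
have [ut0 _ utS] := step.
elim: n => [|n /qd_step_lower_itv_of_pivot/andP[_ lt_lt_u]].
  by rewrite ut0 ltrDr.
by rewrite utS addrAC ltrDr subr_gt0.
Qed.

Lemma qd_step_lower_itv n : 0 < lt n < u n.+1.
Proof. exact/qd_step_lower_itv_of_pivot/qd_step_pivot_gt. Qed.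

Lemma qd_step_pivot_gt0 n : 0 < ut n.
Proof. exact: lt_trans (qd_step_pivot_gt n). Qed.

Lemma qd_step_pivot_le n : ut n <= u n + l n.
Proof.
have [ut0 _ utS] := step; case: n => [|n]; first by rewrite ut0.
by rewrite utS gerBl ltW//; have /andP[] := qd_step_lower_itv n.
Qed.

End Positivity.

Lemma qd_step_bounded (R : realType) (u l ut lt : nat -> R) :
  (forall n, 0 < u n) -> (forall n, 0 < l n) -> qd_step u l ut lt ->
  bounded_fun u -> bounded_fun l -> bounded_fun ut /\ bounded_fun lt.
Proof.
have globally_proper : ProperFilter (globally [set: nat]).
  exact: (globally_properfilter (a := 0%N)).
move=> u_gt0 l_gt0 step /ex_bound[M uM] /ex_bound[N lN].
have u_le n : u n <= M by rewrite (le_trans (ler_norm _))// uM.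
have l_le n : l n <= N by rewrite (le_trans (ler_norm _))// lN.
split; apply/ex_bound.
  exists (M + N) => n _ /=.
  rewrite gtr0_norm; last exact: (qd_step_pivot_gt0 u_gt0 l_gt0 step).
  by rewrite (le_trans (qd_step_pivot_le u_gt0 l_gt0 step n))// lerD.
exists M => n _ /=.
have /andP[lt_gt0 lt_lt] := qd_step_lower_itv u_gt0 l_gt0 step n.
by rewrite gtr0_norm// (le_trans (ltW lt_lt)).
Qed.

(** * Refactorization *)

Theorem lemma2p2 (R : realType) (U L : simx R) (u l : nat -> R)
    (U_upper : upper_bidiagonal U) (L_lower : lower_bidiagonal L)
    (U_diag : forall n : nat, U n n = u n) (u_gt0 : forall n : nat, 0 < u n)
    (U_super : forall n : nat, U n n.+1 = 1)
    (L_diag : forall n : nat, L n n = 1)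
    (L_sub : forall n : nat, L n.+1 n = l n) (l_gt0 : forall n : nat, 0 < l n) :
  (exists! P : simx R * simx R,
     normalized_positive_pair P.1 P.2 /\ simulmx U L = simulmx P.1 P.2) /\
  (forall Lt Ut : simx R,
     normalized_positive_pair Lt Ut -> simulmx U L = simulmx Lt Ut ->
     let lt := fun n : nat => Lt n.+1 n in
     let ut := fun n : nat => Ut n n in
     [/\ ut 0%N = u 0%N + l 0%N,
         forall n : nat, lt n = u n.+1 * l n / ut n
       & forall n : nat, ut n.+1 = u n.+1 + l n.+1 - lt n] /\
     (forall n : nat, l n < ut n) /\
     (forall n : nat, 0 < lt n < u n.+1) /\
     (bounded_fun u -> bounded_fun l -> bounded_fun ut /\ bounded_fun lt)).
Proof.
have -> : U = unit_upper u.
  by rewrite [LHS]normalized_upperE//; congr unit_upper; apply/funext.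
have -> : L = unit_lower l.
  by rewrite [LHS]normalized_lowerE//; congr unit_lower; apply/funext.
have pair_step (Lt Ut : simx R) : normalized_positive_pair Lt Ut ->
    simulmx (unit_upper u) (unit_lower l) = simulmx Lt Ut ->
    qd_step u l (fun n => Ut n n) (fun n => Lt n.+1 n).
  move=> [LtN UtN _ Ut_gt0]; rewrite {1}(normalized_lowerE LtN).
  rewrite {1}(normalized_upperE UtN) => /factorization_eqP; apply => n.
  by rewrite gt_eqF.
split; last first.
  move=> Lt Ut LtUt /(pair_step _ _ LtUt) step; split=> //.
  split; first exact: (qd_step_pivot_gt u_gt0 l_gt0 step).
  split; first exact: (qd_step_lower_itv u_gt0 l_gt0 step).
  exact: (qd_step_bounded u_gt0 l_gt0 step).
have step := qd_step_pivot u l.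
set ut := pivot u l in step *; set lt := (X in qd_step _ _ _ X) in step.
have ut_gt0 := qd_step_pivot_gt0 u_gt0 l_gt0 step.
exists (unit_lower lt, unit_upper ut); split=> /=.
  split; last by apply/factorization_eqP => // n; rewrite gt_eqF.
  split=> [||n|n].
  - exact: normalized_unit_lower.
  - exact: normalized_unit_upper.
  - rewrite unit_lower_sub.
    by have /andP[] := qd_step_lower_itv u_gt0 l_gt0 step n.
  - by rewrite unit_upper_diag.
move=> [Lt Ut] /= [LtUt /(pair_step _ _ LtUt)/(qd_step_uniq step)[-> ->]].
case: LtUt => LtN UtN _ _.
by rewrite -(normalized_lowerE LtN) -(normalized_upperE UtN).
Qed.
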